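(* Let $m \in \mathbb{N}$, let $r := 4m+1$ and let $n \in \mathbb{N}$ be divisible by $2r(r+1)$. Let $G$ be the complete balanced $(r+1)$-partite graph on $n$ vertices (and so $\delta(G) = (1 - 1/(r+1))n$). Then there is a function $f : E(G) \to \{-1, 1\}$ such that every perfect $K_r$-tiling $\mathcal{T}$ in $G$ satisfies $$\sum_{e \in E(\mathcal{T})} f(e) = 0.$$
   Context: $\mathbb{N}$ denotes the positive integers. All graphs are finite and simple. The complete balanced $(r+1)$-partite graph on $n$ vertices (with $r+1$ dividing $n$) has its vertex set partitioned into $r+1$ classes of size $n/(r+1)$ each, with two vertices adjacent if and only if they lie in different classes. $E(G)$ is the edge set and $\delta(G)$ the minimum degree of $G$; $K_r$ is the complete graph on $r$ vertices. A perfect $K_r$-tiling in a graph $G$ is a collection $\mathcal{T}$ of vertex-disjoint copies of $K_r$ contained in $G$ (as subgraphs) that together cover every vertex of $G$. $E(\mathcal{T})$ denotes the set of all edges of $G$ lying in one of the copies of $K_r$ in $\mathcal{T}$. *)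

(* Defs.v *)
From mathcomp Require Import all_boot all_order all_algebra.

Set Implicit Arguments.
Unset Strict Implicit.
Unset Printing Implicit Defensive.

Record sgraph (T : finType) := SGraph {
  adj :> rel T;
  adj_sym : symmetric adj;
  adj_irrefl : irreflexive adj
}.

Section Graphs.

Variables (T : finType) (G : sgraph T).

Definition edges : {set {set T}} :=
  [set e : {set T} | [exists x, exists y, G x y && (e == [set x; y])]].

Definition degree (x : T) : nat := #|[set y | G x y]|.

(* The default value #|T| exceeds every degree, so it only matters when T is
   empty. *)
Definition min_degree : nat := \big[minn/#|T|]_(x : T) degree x.

Definition complete_balanced_multipartite (k n : nat) : Prop :=
  [/\ #|T| = n, k %| n &
      exists P : {set {set T}},
        [/\ partition P [set: T], #|P| = k,
            forall A, A \in P -> #|A| = n %/ k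
          & forall x y, G x y = (pblock P x != pblock P y)]].

(* A copy of K_r in G is represented by its vertex set, which determines it:
   its edges are all the edges of G between its vertices. *)
Definition complete_copy (r : nat) (K : {set T}) : Prop :=
  #|K| = r /\ {in K &, forall x y, x != y -> G x y}.

Definition perfect_tiling (r : nat) (X : {set {set T}}) : Prop :=
  [/\ forall K, K \in X -> complete_copy r K, trivIset X & cover X = [set: T]].

Definition tiling_edges (X : {set {set T}}) : {set {set T}} :=
  [set e in edges | [exists K in X, e \subset K]].

End Graphs.

(* Main.v *)
Require Import Defs.
From mathcomp Require Import all_boot all_order all_algebra.
From mathcomp Require Import zify.

(** Write [P] for the partition of the [r + 1] colour classes, each of the same
    even size, and fix one class [B].  The labelling is

      f e = (sum of s x over the ends x of e) + g (pair of classes joined by e),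

    where [s] is a signing of the vertices of [B], half of them +1 and half -1,
    extended by 0 outside [B], and [g] is a signing of the pairs of classes other
    than [B], again half +1 and half -1, extended by 0 to every other pair.
    An edge has an end in [B] or joins two classes other than [B], never both,
    so exactly one of the two terms is nonzero and f takes values in {-1, 1}.
    Both signings exist because an even set can be halved: [B] has even size,
    and the number of pairs of classes other than [B] is the binomial coefficient
    of [r = 4m + 1] over 2, which is [2m (4m + 1)].

    Both terms have sum zero over the edges of any perfect tiling.
    - Every vertex lies in one copy of K_r, hence on exactly [r - 1] tiling edges
      ([degree_tiling_graph]).  The first term therefore contributes
      [(r - 1) * \sum_x s x = 0].
    - A copy of K_r has at most one vertex in each of the [r + 1] classes, so it
      misses exactly one class, and at most one of two classes [U] and [V].
      If [u] and [v] are the numbers, 0 or 1, of its vertices in [U] and [V], then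
      [u * v = u + v - 1] ([card_copy_two_parts]).  Summed over the tiling, this
      says that the number of tiling edges between [U] and [V] is
      [#|U| + #|V| - #|X|] ([count_tiling_pairs]), which is the same for all pairs
      of classes.  The second term contributes that constant times the sum of
      [g], which is 0.

    Sums over edges are evaluated as sums over ordered pairs of adjacent vertices,
    which are twice as large ([sum_edges]). *)

Import GRing.Theory Num.Theory.

Set Implicit Arguments.
Unset Strict Implicit.

Local Open Scope ring_scope.

(** * Balanced signings and edge sums *)

(** The value 0 outside [A] allows a signing of some edges and a signing of the
    others to be combined by adding them. *)
Lemma exists_balanced_signing (T : finType) (A : {set T}) :
  ~~ odd #|A| ->
  exists s : T -> int,
    [/\ {in A, forall x, s x = -1 \/ s x = 1},
        forall x, x \notin A -> s x = 0
      & \sum_x s x = 0].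
Proof.
move=> evA.
have [B] : exists B, B \in [set B : {set T} | B \subset A & #|B| == #|A|./2].
  by apply/card_gt0P; rewrite cards_draws bin_gt0; lia.
rewrite inE => /andP[sBA /eqP cB].
(* +1 on the half [B], -1 on the rest of [A]. *)
exists (fun x => (x \in B)%:R *+ 2 - (x \in A)%:R); split.
- move=> x ->; case: (x \in B); [by right | by left].
- move=> x xA; have /negbTE-> : x \notin B by apply: contra xA; apply: subsetP.
  by rewrite (negbTE xA).
rewrite sumrB sumrMnl -!natr_sum -!big_mkcond !sum1_card cB.
by lia.
Qed.

Lemma eq_set2 {T : finType} (a b x y : T) :
  ([set x; y] == [set a; b]) =
  (x == a) && (y == b) || (x == b) && (y == a).
Proof.
apply/eqP/idP => [eq_xy|]; last first.
  by case/orP=> /andP[/eqP-> /eqP->] //; rewrite setUC.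
have: [&& x \in [set a; b], y \in [set a; b], a \in [set x; y] & b \in [set x; y]].
  by rewrite -{1 2}eq_xy {3 4}eq_xy !set21 !set22.
rewrite !inE (eq_sym a x) (eq_sym a y) (eq_sym b x) (eq_sym b y).
by case: (x == a); case: (x == b); case: (y == a); case: (y == b).
Qed.

Lemma edges_set2 {T : finType} (G : sgraph T) (x y : T) :
  ([set x; y] \in edges G) = G x y.
Proof.
rewrite inE; apply/existsP/idP => [[a /existsP[b /andP[Gab]]]|Gxy].
  by rewrite eq_set2 => /orP[]/andP[/eqP-> /eqP->] //; rewrite adj_sym.
by exists x; apply/existsP; exists y; rewrite Gxy eqxx.
Qed.

Lemma edgesP {T : finType} (G : sgraph T) (e : {set T}) :
  reflect (exists x y, G x y /\ e = [set x; y]) (e \in edges G).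
Proof.
apply: (iffP idP) => [|[x [y [Gxy ->]]]]; last by rewrite edges_set2.
by rewrite inE => /existsP[x /existsP[y /andP[Gxy /eqP->]]]; exists x, y.
Qed.

(** Each edge [{a, b}] arises from the two ordered pairs [(a, b)] and [(b, a)].
    Stated for any graph, this also serves for pairs of colour classes, which are
    the edges of the complete graph on the set of classes. *)
Lemma sum_edges {T : finType} (G : sgraph T) (F : {set T} -> int) :
  \sum_x \sum_(y | G x y) F [set x; y] = (\sum_(e in edges G) F e) *+ 2.
Proof.
rewrite pair_big_dep /=.
rewrite (partition_big (fun p : T * T => [set p.1; p.2]) (mem (edges G))) /=;
  last by case=> x y /= Gxy; rewrite edges_set2.
rewrite -sumrMnl; apply: eq_bigr => e /edgesP[a [b [Gab ->]]].
have nab : a != b by apply: contraTneq Gab => ->; rewrite adj_irrefl.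
rewrite (eq_bigr (fun=> F [set a; b])); last by move=> p /andP[_ /eqP->].
rewrite sumr_const; congr (_ *+ _).
rewrite (eq_card (B := [set (a, b); (b, a)])).
  by rewrite cards2 xpair_eqE (negbTE nab).
case=> x y; rewrite !inE unfold_in /= eq_set2 !xpair_eqE andb_idl //.
by case/orP=> /andP[/eqP-> /eqP->] //; rewrite adj_sym.
Qed.

Definition clique_on {T : finType} (A : {set T}) : sgraph T.
Proof.
exists (fun x y => [&& x \in A, y \in A & x != y]) => [x y | x].
  by rewrite andbCA eq_sym.
by rewrite eqxx !andbF.
Defined.

Lemma card_edges_clique_on {T : finType} (A : {set T}) :
  #|edges (clique_on A)| = 'C(#|A|, 2).
Proof.
rewrite -cards_draws; congr #|pred_of_set _|; apply/setP=> e; rewrite [RHS]inE.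
apply/edgesP/andP => [[x [y [/and3P[xA yA nxy] ->]]] | [sEA /cards2P[x [y [nxy Exy]]]]].
  by rewrite subUset !sub1set xA yA cards2 nxy.
exists x, y; split=> //; move: sEA; rewrite Exy subUset !sub1set => /andP[xA yA].
by apply/and3P.
Qed.

(** * The graph of a perfect tiling *)

(** Viewing the tiling edges as the edge set of a graph makes [sum_edges]
    applicable to them. *)
Definition tiling_graph {T : finType} (X : {set {set T}}) : sgraph T.
Proof.
exists (fun x y => (x != y) && (pblock X x == pblock X y)) => [x y | x].
  by rewrite eq_sym; congr (_ && _); rewrite eq_sym.
by rewrite eqxx.
Defined.

Lemma tiling_edgesE {T : finType} (G : sgraph T) r (X : {set {set T}}) :
  perfect_tiling G r X -> tiling_edges G X = edges (tiling_graph X).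
Proof.
case=> copyX tiX covX; apply/setP=> e; rewrite inE.
apply/andP/edgesP=> [[/edgesP[x [y [Gxy ->]]] /existsP[K /andP[XK]]] | [x [y [Hxy ->]]]].
  rewrite subUset !sub1set => /andP[xK yK]; exists x, y; split=> //=.
  rewrite !(def_pblock tiX XK) // eqxx andbT.
  by apply: contraTneq Gxy => ->; rewrite adj_irrefl.
have [nxy /eqP Bxy] := andP Hxy.
have xX : x \in cover X by rewrite covX inE.
have yB : y \in pblock X x by rewrite Bxy mem_pblock covX inE.
have XB := pblock_mem xX.
have xB : x \in pblock X x by rewrite mem_pblock.
split; first by rewrite edges_set2; case: (copyX _ XB) => _; apply.
by apply/existsP; exists (pblock X x); rewrite XB subUset !sub1set xB.
Qed.

(** A vertex is needed: on the empty graph the minimum takes its default value,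
    whatever [d] is. *)
Lemma min_degree_regular {T : finType} (G : sgraph T) (d : nat) :
  (0 < #|T|)%N -> (forall x, degree G x = d) -> min_degree G = d.
Proof.
move=> /card_gt0P[x0 _] degG; rewrite /min_degree.
have led : (d <= #|T|)%N by rewrite -(degG x0) max_card.
rewrite (eq_bigr (fun=> d)) // big_const.
have : (0 < #|T|)%N by apply/card_gt0P; exists x0.
case: #|T| led => // k led _; rewrite iterS; apply/minn_idPl.
by elim: {1}k => //= j IHj; rewrite leq_min leqnn IHj.
Qed.

(** Double counting of the pairs of a copy [K] and a vertex [x] of [K :&: U]. *)
Lemma sum_pblock {T : finType} (X : {set {set T}}) (U : {set T}) (F : {set T} -> nat) :
  trivIset X -> cover X = [set: T] ->
  (\sum_(x in U) F (pblock X x) = \sum_(K in X) #|K :&: U| * F K)%N.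
Proof.
move=> tiX covX; rewrite big_mkcond /=.
rewrite (eq_bigl (mem (cover X))); last by move=> x; rewrite covX !inE.
rewrite big_trivIset //; apply: eq_bigr => K XK.
rewrite -sum_nat_const -big_mkcondr; apply: eq_big => [x | x /andP[xK _]].
  by rewrite inE.
by rewrite (def_pblock tiX XK).
Qed.

Lemma card_pblock {T : finType} (X : {set {set T}}) (U : {set T}) :
  trivIset X -> cover X = [set: T] ->
  (#|U| = \sum_(K in X) #|K :&: U|)%N.
Proof.
move=> tiX covX; rewrite -sum1_card (sum_pblock _ (fun=> 1%N) tiX covX).
by apply: eq_bigr => K _; rewrite muln1.
Qed.

(** * Tilings of complete multipartite graphs *)

Section Multipartite.

Context {T : finType} (G : sgraph T) (P : {set {set T}}) (r : nat).
Hypothesis partP : partition P [set: T].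
Hypothesis cardP : #|P| = r.+1.
Hypothesis adjE : forall x y, G x y = (pblock P x != pblock P y).

Let tiP : trivIset P. Proof. by case/and3P: partP. Qed.
Let covP : cover P = [set: T]. Proof. by case/and3P: partP => /eqP. Qed.

Lemma card_copy_part (K U : {set T}) :
  complete_copy G r K -> U \in P -> (#|K :&: U| <= 1)%N.
Proof.
case=> _ adjK PU; apply/card_le1_eqP => x y; rewrite !inE => /andP[xK xU] /andP[yK yU].
apply/eqP; apply: contraT => nxy; have := adjK _ _ yK xK nxy.
by rewrite adjE !(def_pblock tiP PU) // eqxx.
Qed.

(** The [r] vertices of [K] lie in distinct classes among [r + 1], so [K] cannot
    miss both [U] and [V]: the other classes would supply at most [r - 1]
    vertices.  Hence at least one of the two numbers is 1, and
    [(1 - u) * (1 - v) = 0]; the form below avoids truncated subtraction. *)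
Lemma card_copy_two_parts (K U V : {set T}) :
  complete_copy G r K -> U \in P -> V \in P -> U != V ->
  (#|K :&: U| * #|K :&: V| + 1 = #|K :&: U| + #|K :&: V|)%N.
Proof.
move=> copyK PU PV nUV.
have leU := card_copy_part copyK PU; have leV := card_copy_part copyK PV.
have [] := copyK; rewrite (card_pblock K tiP covP).
rewrite (bigD1 U) //= (bigD1 V) /=; last by rewrite PV eq_sym.
set rest := (X in (_ + (_ + X))%N) => sumr _.
have ler : (rest + 2 <= r.+1)%N.
  rewrite -cardP (cardD1 U) PU (cardD1 V) !inE PV eq_sym nUV !add1n addn2 !ltnS.
  rewrite -sum1_card /rest.
  rewrite [leqRHS](eq_bigl (fun W => (W \in P) && (W != U) && (W != V))); last first.
    by move=> W; rewrite !inE andbC [X in X && _]andbC.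
  apply: leq_sum => W /andP[/andP[PW _] _]; rewrite setIC.
  exact: card_copy_part copyK PW.
move: sumr ler leU leV; rewrite (setIC K U) (setIC K V).
by case: #|U :&: K| => [|[|?]] //; case: #|V :&: K| => [|[|?]] //; lia.
Qed.

(** The left-hand sum counts the tiling edges between [U] and [V].  Since it is
    determined by [#|U|], [#|V|] and [#|X|], no tiling can favour one pair of
    classes over another pair of the same sizes. *)
Lemma count_tiling_pairs (X : {set {set T}}) (U V : {set T}) :
  perfect_tiling G r X -> U \in P -> V \in P -> U != V ->
  (\sum_(x in U) #|pblock X x :&: V| + #|X| = #|U| + #|V|)%N.
Proof.
case=> copyX tiX covX PU PV nUV.
rewrite (sum_pblock _ (fun K : {set T} => #|K :&: V|) tiX covX).
rewrite (card_pblock U tiX covX) (card_pblock V tiX covX) -sum1_card -!big_split /=.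
by apply: eq_bigr => K /copyX copyK; apply: card_copy_two_parts.
Qed.

(** The condition on the diagonal is there because no tiling edge joins a class
    to itself, while the right-hand side also ranges over [U = V]. *)
Lemma sum_tiling_parts (X : {set {set T}}) (g : {set T} -> {set T} -> int) :
  perfect_tiling G r X -> (forall U, g U U = 0) ->
  \sum_x \sum_(y | tiling_graph X x y) g (pblock P x) (pblock P y) =
  \sum_(U in P) \sum_(V in P) g U V * (#|U|%:R + #|V|%:R - #|X|%:R).
Proof.
move=> tilX g0; have [_ tiX covX] := tilX.
have sumT (F : T -> int) : \sum_x F x = \sum_(U in P) \sum_(x in U) F x.
  by rewrite -big_trivIset // covP; apply: eq_bigl => x; rewrite inE.
rewrite sumT; apply: eq_bigr => U PU.
under eq_bigr => x xU do rewrite big_mkcond sumT /=.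
rewrite exchange_big /=; apply: eq_bigr => V PV.
under eq_bigr => x xU.
  under eq_bigr => y yV do
    rewrite (def_pblock tiP PU xU) (def_pblock tiP PV yV).
  over.
have [<- | nUV] := eqVneq U V.
  by rewrite g0 mul0r; apply: big1 => x _; apply: big1 => y _; case: ifP.
have -> : #|U|%:R + #|V|%:R - #|X|%:R = \sum_(x in U) #|pblock X x :&: V|%:R :> int.
  by rewrite -natr_sum -natrD -(count_tiling_pairs tilX PU PV nUV) natrD addrK.
rewrite mulr_sumr; apply: eq_bigr => x xU.
rewrite -big_mkcondr /= sumr_const mulr_natr; congr (_ *+ _).
apply: eq_card => y; rewrite !inE unfold_in /=.
have [yV | _] := boolP (y \in V); rewrite ?andbF //= andbT.
have -> : x != y.
  by apply: contraNneq nUV => xy; rewrite -(def_pblock tiP PU xU) xy (def_pblock tiP PV yV).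
by rewrite eq_pblock // covX inE.
Qed.

Lemma degree_tiling_graph (X : {set {set T}}) (x : T) :
  perfect_tiling G r X -> degree (tiling_graph X) x = r.-1.
Proof.
case=> copyX tiX covX.
have xX : x \in cover X by rewrite covX inE.
have [cardB _] := copyX _ (pblock_mem xX).
rewrite -cardB (cardsD1 x) mem_pblock xX /degree; apply: eq_card => y.
by rewrite !inE /= eq_sym eq_pblock.
Qed.

(** Both kinds of labelling are invisible to perfect tilings: [s] because the
    tiling graph is regular, [g] because tilings join all pairs of classes
    equally often. *)
Lemma sum_tiling_edges0 (X : {set {set T}}) (N : nat)
    (s : T -> int) (g : {set {set T}} -> int) :
  perfect_tiling G r X -> (forall U, U \in P -> #|U| = N) ->
  \sum_x s x = 0 ->
  (forall Q, Q \notin edges (clique_on P) -> g Q = 0) -> \sum_Q g Q = 0 ->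
  \sum_(e in tiling_edges G X) (\sum_(x in e) s x + g (pblock P @: e)) = 0.
Proof.
move=> tilX cardU s0 gout g0; apply/eqP; rewrite (tiling_edgesE tilX).
suff: (\sum_(e in edges (tiling_graph X))
    (\sum_(x in e) s x + g (pblock P @: e))) *+ 2 = 0 by lia.
rewrite -sum_edges.
transitivity (\sum_x \sum_(y | tiling_graph X x y)
    (s x + s y + g [set pblock P x; pblock P y])).
  apply: eq_bigr => x _; apply: eq_bigr => y /andP[nxy _].
  by rewrite imsetU1 imset_set1 big_setU1 ?inE //= big_set1.
have sum_s : \sum_x \sum_(y | tiling_graph X x y) s x = 0.
  transitivity (\sum_x s x *+ r.-1); last by rewrite sumrMnl s0 mul0rn.
  apply: eq_bigr => x _; rewrite sumr_const -(degree_tiling_graph x tilX).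
  by congr (_ *+ _); apply: eq_card => y; rewrite !inE.
have sum_s' : \sum_x \sum_(y | tiling_graph X x y) s y = 0.
  rewrite (exchange_big_dep xpredT) //= -[RHS]sum_s.
  by apply: eq_bigr => y _; apply: eq_bigl => x; rewrite -[LHS]/(tiling_graph X x y) adj_sym.
under eq_bigr => x _ do rewrite !big_split /=.
rewrite !big_split /= sum_s sum_s' !add0r.
rewrite (sum_tiling_parts (g := fun U V => g [set U; V]) tilX); last first.
  by move=> U; apply: gout; rewrite edges_set2 adj_irrefl.
transitivity (\sum_U \sum_(V | clique_on P U V)
    g [set U; V] * (N%:R + N%:R - #|X|%:R)).
  rewrite big_mkcond; apply: eq_bigr => U _; case: ifPn => [PU | PU]; last first.
    by rewrite big1 // => V /and3P[]; rewrite (negbTE PU).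
  rewrite big_mkcond [RHS]big_mkcond; apply: eq_bigr => V _.
  have [PV | PV] := boolP (V \in P); last by rewrite /= (negbTE PV) andbF.
  rewrite (cardU U) // (cardU V) //; case: ifPn => // nUV.
  by rewrite gout ?mul0r // edges_set2.
rewrite (sum_edges _ (fun Q => g Q * _)) -mulr_suml.
have -> : \sum_(Q in edges (clique_on P)) g Q = 0.
  by rewrite -[RHS]g0 big_mkcond; apply: eq_bigr => Q _; case: ifPn => // /gout ->.
by rewrite mul0r mul0rn.
Qed.

Lemma multipartite_degree (N : nat) (x : T) :
  (forall U, U \in P -> #|U| = N) -> degree G x = (#|T| - N)%N.
Proof.
move=> cardU; have xP : x \in cover P by rewrite covP inE.
rewrite -(cardU _ (pblock_mem xP)) -(cardsC (pblock P x)) addKn /degree.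
by congr #|pred_of_set _|; apply/setP=> y; rewrite !inE adjE eq_pblock.
Qed.

End Multipartite.

Unset Implicit Arguments.

Theorem proposition3p1 (m r n : nat) (hm : (0 < m)%N) (hr : r = (4 * m + 1)%N)
    (hn : (0 < n)%N) (hdvd : (2 * r * r.+1 %| n)%N)
    (T : finType) (G : sgraph T)
    (hG : complete_balanced_multipartite G r.+1 n) :
  (min_degree G)%:R = (1 - 1 / r.+1%:R) * n%:R :> rat /\
  exists f : {set T} -> int,
    (forall e : {set T}, e \in edges G -> f e = -1 \/ f e = 1) /\
    (forall X : {set {set T}}, perfect_tiling G r X ->
       \sum_(e in tiling_edges G X) f e = 0).
Proof.
case: hG => cardT dvdn_r [P [partP cardP cardU adjE]].
set N := (n %/ r.+1)%N in cardU.
have nE : n = (N * r.+1)%N by rewrite /N divnK.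
have evN : ~~ odd N.
  case/dvdnP: hdvd => q; rewrite nE !mulnA => /eqP; rewrite eqn_pmul2r // => /eqP->.
  by rewrite !oddM /= andbF.
split.
  rewrite (@min_degree_regular _ _ (n - N)) ?cardT //; last first.
    by move=> x; rewrite (multipartite_degree partP adjE _ cardU) cardT.
  rewrite natrB; last by rewrite nE leq_pmulr.
  by rewrite nE natrM mulrBl mul1r (mulrC _^-1) mulfK ?mul1r ?pnatr_eq0.
have [B PB] : exists B, B \in P by apply/card_gt0P; rewrite cardP.
have evB : ~~ odd #|B| by rewrite cardU.
have [s [sB sout s0]] := exists_balanced_signing evB.
have evD : ~~ odd #|edges (clique_on (P :\ B))|.
  have cardPB : #|P :\ B| = r by move: (cardsD1 B P); rewrite PB cardP; lia.
  by rewrite card_edges_clique_on cardPB bin2 hr; lia.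
have [g [gD gout g0]] := exists_balanced_signing evD.
exists (fun e : {set T} => \sum_(x in e) s x + g (pblock P @: e)); split; last first.
  move=> X tilX; apply: (sum_tiling_edges0 partP cardP adjE tilX cardU s0 _ g0) => Q.
  move=> nQ; apply: gout; apply: contra nQ => /edgesP[U [V [+ ->]]].
  by rewrite edges_set2 => /and3P[/setD1P[_ PU] /setD1P[_ PV] nUV]; apply/and3P.
have [/eqP covP tiP _] := and3P partP.
have Ppb z : pblock P z \in P by rewrite pblock_mem ?covP ?inE.
have inB z : (z \in B) = (pblock P z == B).
  by apply/idP/eqP => [/(def_pblock tiP PB) // | <-]; rewrite mem_pblock covP inE.
move=> e /edgesP[x [y [Gxy ->]]].
have nxy : x != y by apply: contraTneq Gxy => ->; rewrite adj_irrefl.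
rewrite imsetU1 imset_set1 big_setU1 ?inE //= big_set1.
have gB U V : U = B \/ V = B -> g [set U; V] = 0.
  move=> UVB; apply: gout; rewrite edges_set2 /= !inE.
  by case: UVB => ->; rewrite eqxx ?andbF.
(* At most one end lies in [B]; [s] labels the edge if there is one, [g] if not. *)
move: Gxy; rewrite adjE.
have [xB | xB] := eqVneq (pblock P x) B.
  rewrite xB eq_sym -inB => yB; rewrite (sout y) // gB; last by left.
  by rewrite !addr0; apply: sB; rewrite inB xB.
have [yB _ | yB nUV] := eqVneq (pblock P y) B.
  rewrite (sout x) ?inB // gB; last by right.
  by rewrite addr0 add0r; apply: sB; rewrite inB yB.
rewrite !sout ?inB // !add0r; apply: gD; rewrite edges_set2.
by rewrite /= !inE xB yB !Ppb.
Qed.
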